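(* Let $T>0$ and let $x:[0,T]\to\mathbb{R}$ be a càdlàg function. Let $(\pi^n)_{n\in\mathbb{N}}$ be a sequence of partitions of $(0,T]$ satisfying, with respect to $x$, the assumptions (A1) and (A2) spelled out in the context. Let $[x]:[0,T]\to[0,+\infty)$, $t\mapsto[x]_t$, be a non-decreasing function such that for every $t\in[0,T]$ at which $[x]$ is continuous, for $t=T$, and for every $t\in(0,T]$ at which $x$ has a jump, the following limit exists and $$\lim_{n\to+\infty}\sum_{(u,v]\in\pi^n}\left(x(v\wedge t)-x(u\wedge t)\right)^2=[x]_t .$$ Then for any twice continuously differentiable $f:\mathbb{R}\to\mathbb{R}$, the finite limit $$I:=\lim_{n\to+\infty}\sum_{(u,v]\in\pi^n}f''(x(u))\left(x(v)-x(u)\right)^2$$ exists. As a result, the limit $$\lim_{n\to+\infty}\sum_{(u,v]\in\pi^n}f'(x(u))\left(x(v)-x(u)\right)$$ also exists and is equal to $$f(x(T))-f(x(0))-\tfrac12 I-J,$$ where $$J=\sum_{t\in D}\left\{f(x(t))-f(x(t-))-f'(x(t-))\Delta x(t)-\tfrac12 f''(x(t-))\left(\Delta x(t)\right)^2\right\}$$ and $D=\{t\in(0,T]:|\Delta x(t)|>0\}$.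
   Context: Càdlàg means right-continuous with left limits. For $t\in(0,T]$, $x(t-)$ is the left limit of $x$ at $t$ and $\Delta x(t):=x(t)-x(t-)$; $x$ has a jump at $t\in(0,T]$ if $\Delta x(t)\neq0$. $a\wedge b$ denotes $\min(a,b)$. A partition of $(0,T]$ is a finite sequence $\pi=\left((t_i,t_{i+1}]\right)_{i=0}^{k-1}$ of intervals with $0=t_0<t_1<\dots<t_k=T$. A sequence of partitions $(\pi^n)_{n\in\mathbb{N}}$ of $(0,T]$ is a sequence in which each $\pi^n$ is a partition of $(0,T]$; no assumption that the mesh tends to $0$ is made, and the partitions need not be nested. For a partition $\pi$ and $s\in(0,T]$, $\underline{\pi}(s):=u$ where $(u,v]$ is the unique interval of $\pi$ containing $s$. For $\varepsilon>0$ put $D(\varepsilon)=\{t\in(0,T]:|\Delta x(t)|\ge\varepsilon\}$ (a finite set) and define $J_\varepsilon(x):[0,T]\to\mathbb{R}$ by $J_\varepsilon(x)(t):=\sum_{s\in D(\varepsilon)\cap[0,t]}\Delta x(s)$. For $y:[0,T]\to\mathbb{R}$ and $A\subseteq[0,T]$ let $\omega(y;A):=\sup_{s,t\in A}|y(t)-y(s)|$, and for a partition $\pi$ of $(0,T]$ let $O(y;\pi):=\max_{(u,v]\in\pi}\omega(y;(u,v])$. The assumptions on $(\pi^n)$ relative to $x$ are: (A1) $\displaystyle\limsup_{\varepsilon\to0+}\limsup_{n\to+\infty}O\left(x-J_\varepsilon(x);\pi^n\right)=0$. (A2) For any $s\in(0,T]$, $\displaystyle\lim_{n\to+\infty}x\left(\underline{\pi^n}(s)\right)=x(s-)$.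 It is not assumed that the jumps of $[x]$ occur only at times when $x$ jumps, nor that the limit defining the quadratic variation exists at other times $t$. *)

(* Defs.v *)
From mathcomp Require Import all_boot all_order all_algebra.
From mathcomp Require Import all_classical all_reals all_analysis.

Set Implicit Arguments.
Unset Strict Implicit.
Unset Printing Implicit Defensive.

Import Order.TTheory GRing.Theory Num.Theory.
Import numFieldNormedType.Exports.

Local Open Scope classical_set_scope.
Local Open Scope ring_scope.

(* MathComp-Analysis. A function on [0, T] is represented by a total function
   R -> R; only its values on [0, T] are ever used: limits at points of [0, T]
   are one-sided or taken within [0, T]. *)

Section Defs.
Variable R : realType.
Implicit Types (T t eps : R) (x y f : R -> R) (pi : seq R).

Definition cadlag T x : Prop :=
  (forall t, 0 <= t < T -> x s @[s --> t^'+] --> x t) /\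
  (forall t, 0 < t <= T -> cvg (x s @[s --> t^'-])).

Definition left_limit x t : R := lim (x s @[s --> t^'-]).

Definition jump x t : R := x t - left_limit x t.

Definition jumps_ge T x eps : set R :=
  [set t | 0 < t <= T /\ eps <= `|jump x t|].

Definition jumps T x : set R := [set t | 0 < t <= T /\ 0 < `|jump x t|].

(* For cadlag x and eps > 0 the index set is finite, so that this is the
   ordinary finite sum. *)
Definition large_jumps T x eps t : R :=
  \sum_(s \in jumps_ge T x eps `&` `[0, t]) jump x s.

(* A partition of (0, T] is given by pi = [:: t_1; ...; t_k] such that
   itv_partition 0 T pi, i.e. 0 < t_1 < ... < t_k and t_k = T; the interval
   (u, v] is represented by the pair (u, v). *)
Definition intervals pi : seq (R * R) := zip (0 :: pi) pi.

Definition lower_endpoint pi s : R :=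
  (head (0, 0) [seq uv <- intervals pi | uv.1 < s <= uv.2]).1.

Definition oscillation y (A : set R) : \bar R :=
  ereal_sup [set `|y st.2 - y st.1|%:E | st in A `*` A].

Definition max_oscillation y pi : \bar R :=
  \big[maxe/-oo%E]_(uv <- intervals pi) oscillation y `]uv.1, uv.2].

Definition quadratic_sum x pi t : R :=
  \sum_(uv <- intervals pi) (x (Num.min uv.2 t) - x (Num.min uv.1 t)) ^+ 2.

Definition twice_continuously_differentiable f : Prop :=
  [/\ forall a, derivable f a 1,
      forall a, derivable (derive1 f) a 1 &
      continuous (derive1n 2 f)].

Definition jump_correction f x t : R :=
  f (x t) - f (left_limit x t) - derive1 f (left_limit x t) * jump x t
  - 2^-1 * derive1n 2 f (left_limit x t) * jump x t ^+ 2.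

(* Unordered sum of a real family; meaningful when g is summable on D. *)
Definition unordered_sum (D : set R) (g : R -> R) : R :=
  fine (\esum_(t in D) (EFin \o g)^\+ t - \esum_(t in D) (EFin \o g)^\- t)%E.

End Defs.

(* Main.v *)
Require Import Defs.
From mathcomp Require Import all_boot all_order all_algebra.
From mathcomp Require Import all_classical all_reals all_analysis.
From mathcomp Require Import finmap ring lra.

Set Implicit Arguments.
Unset Strict Implicit.
Unset Printing Implicit Defensive.

Import Order.TTheory GRing.Theory Num.Theory.
Import numFieldNormedType.Exports.

Local Open Scope classical_set_scope.
Local Open Scope ring_scope.

(** The partitions need not become finer, so uniform continuity in time is
    replaced by two facts about the interval (u, v] of the n-th partition that
    contains a fixed time s. By hypothesis x(u) tends to x(s-). If x jumps at s,
    then v also tends to s: a time t slightly after s in the same interval would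
    force x(s-) to be close to x(t-), hence to x(s) ([jump_interval_shrinks]).
    So x(v) tends to x(s), and distinct jump times end up in distinct intervals.

    Existence of I. Let phi be f'' and stop all sums at a time t. Call t reached
    if, up to an error of eta times the quadratic sum, the weighted sums stopped
    at t are asymptotic to a convergent sequence. If phi \o x varies by at most
    eta on [s, t) and the quadratic sums converge at s and at t, then t is
    reached whenever s is ([nearly_convergent_step]): from s to t the weighted
    sum grows by nearly phi(x(s)) times the growth of the quadratic sum. The
    interval that straddles s is the only obstacle. Either x jumps at s and
    this interval shrinks to s, or x(u) tends to x(s) and the interval gets the
    weight phi(x(s)) anyway. The quadratic sums converge at T, at the jump times,
    and at a dense set of times, because a monotone function has a dense set of
    continuity points. As x is cadlag, a supremum argument shows that T is
    reached ([nearly_convergent_T]), and eta is arbitrary.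

    The second limit. Write f(x(v)) - f(x(u)) as f'(x(u)) (x(v) - x(u)), plus half
    of f''(x(u)) (x(v) - x(u))^2, plus a Taylor remainder. The left-hand sides
    telescope, so it remains to see that the remainders add up to J in the limit
    ([taylor_remainder_sum_cvg]). The intervals around a finite set of jump
    times contribute in the limit the remainders between x(s-) and x(s), which
    are the terms of J. If the finite set contains all the jumps of size at
    least eps, then x minus its large jumps oscillates little on every other
    interval, and so does x; the other intervals thus contribute at most a small
    multiple of the quadratic sum. The series J is summable because its terms are
    dominated by squared jumps, whose sum is at most [x]_T
    ([sum_jump_sqr_le]). *)

(** * Intervals of a partition *)

Section Partitions.
Variable R : realType.
Implicit Types (a b s t T : R) (p : seq R) (uv : R * R).

Definition contains s uv : bool := uv.1 < s <= uv.2.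

Definition interval_at p s : R * R :=
  head (0, 0) [seq uv <- intervals p | contains s uv].

Lemma zip_path_bounds a p uv : path <%R a p -> uv \in zip (a :: p) p ->
  [/\ a <= uv.1, uv.1 < uv.2 & uv.2 <= last a p].
Proof.
elim: p a => [|b p IH] a //= /andP[ab pb]; rewrite inE => /orP[/eqP ->/=|/(IH _ pb)].
  split=> //; move: pb; rewrite lt_path_sortedE => /andP[/allP h _].
  by have := mem_last b p; rewrite inE => /predU1P[->//|/h/ltW].
by case=> h1 h2 h3; split=> //; apply: le_trans h1; exact: ltW.
Qed.

Lemma zip_path_filter a p s : path <%R a p -> a < s <= last a p ->
  exists uv, [seq uv <- zip (a :: p) p | contains s uv] = [:: uv].
Proof.
elim: p a => [|b p IH] a /=; first by move=> _ /andP[h1 h2]; lra.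
move=> /andP[ab pb] /andP[as_ sl].
have [sb|bs] := leP s b.
  exists (a, b); rewrite {1}/contains /= as_ sb /=; congr cons.
  rewrite -(filter_pred0 (zip (b :: p) p)); apply: eq_in_filter => uv.
  move=> /(zip_path_bounds pb)[h _ _]; rewrite /contains /=.
  by apply/negbTE; rewrite negb_and -leNgt (le_trans sb h).
have [|uv e] := IH _ pb; first by rewrite bs.
by exists uv; rewrite {1}/contains /= [s <= b]leNgt bs andbF.
Qed.

Lemma interval_bounds T p uv : itv_partition 0 T p -> uv \in intervals p ->
  [/\ 0 <= uv.1, uv.1 < uv.2 & uv.2 <= T].
Proof. by case=> pp /eqP <- /(zip_path_bounds pp). Qed.

Lemma filter_contains T p s : itv_partition 0 T p -> 0 < s <= T ->
  [seq uv <- intervals p | contains s uv] = [:: interval_at p s].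
Proof.
case=> pp /eqP <- /(zip_path_filter pp)[uv].
by rewrite /interval_at /intervals => ->.
Qed.

Lemma interval_atP T p s : itv_partition 0 T p -> 0 < s <= T ->
  interval_at p s \in intervals p /\ contains s (interval_at p s).
Proof.
move=> pT sT; have := mem_head (interval_at p s) [::].
by rewrite -(filter_contains pT sT) mem_filter => /andP[].
Qed.

Lemma interval_at_unique T p s uv : itv_partition 0 T p -> 0 < s <= T ->
  uv \in intervals p -> contains s uv -> uv = interval_at p s.
Proof.
move=> pT sT uvp c; apply/eqP; rewrite -mem_seq1 -(filter_contains pT sT).
by rewrite mem_filter c.
Qed.

Lemma sum_contains T p s (F : R * R -> R) : itv_partition 0 T p -> 0 < s <= T ->
  \sum_(uv <- intervals p | contains s uv) F uv = F (interval_at p s).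
Proof. by move=> pT sT; rewrite -big_filter (filter_contains pT sT) big_seq1. Qed.

Lemma sum_increments T p (h : R -> R) : itv_partition 0 T p ->
  \sum_(uv <- intervals p) (h uv.2 - h uv.1) = h T - h 0.
Proof.
case=> _ /eqP <-; rewrite /intervals.
suff H a : \sum_(uv <- zip (a :: p) p) (h uv.2 - h uv.1) = h (last a p) - h a.
  exact: H.
elim: p a => [|b p IH] a /=; first by rewrite big_nil subrr.
by rewrite big_cons IH /=; ring.
Qed.

End Partitions.

(** * Supremum arguments *)

Section RealInduction.
Variable R : realType.

(** Real induction for sets that need not be intervals: from points of A just
    below any c the set A must get past c. At the supremum of A this is only
    possible if A contains T. *)
Lemma forward_chain (T : R) (A : set R) :
  (forall t, A t -> 0 <= t <= T) -> A 0 ->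
  (forall c, 0 <= c <= T -> exists2 d, 0 < d &
     forall s, A s -> c - d < s <= c -> A T \/ exists2 t, A t & c < t) ->
  A T.
Proof.
move=> AT A0 step; have supA : has_sup A.
  by split; [exists 0|exists T => t /AT/andP[]].
have ubA := sup_upper_bound supA.
have c0T : 0 <= sup A <= T.
  rewrite ubA//=; apply: ge_sup; first by exists 0.
  by move=> t /AT/andP[].
have [d d0 H] := step _ c0T; have [s As sd] := sup_adherent d0 supA.
have /(H _ As)[//|[t At]] : sup A - d < s <= sup A by rewrite sd ubA.
by rewrite ltNge ubA.
Qed.

End RealInduction.

(** * Cadlag functions *)

Section Cadlag.
Variables (R : realType) (T : R) (x : R -> R).
Hypothesis xc : cadlag T x.
Implicit Types (s t w c d e : R).

Lemma cadlag_left_cvg t : 0 < t <= T ->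
  x s @[s --> t^'-] --> left_limit x t.
Proof. by case: xc => _; apply. Qed.

Lemma left_limit_dist t a c e : a < t <= T -> 0 <= a ->
  (forall w, a < w < t -> `|x w - c| <= e) -> `|left_limit x t - c| <= e.
Proof.
move=> /andP[at_ tT] a0 H.
have /cadlag_left_cvg xt : 0 < t <= T by rewrite (le_lt_trans a0 at_).
have xtc : `|x s - c| @[s --> t^'-] --> `|left_limit x t - c|.
  by apply: cvg_norm; apply: cvgB => //; exact: cvg_cst.
rewrite -(cvg_lim _ xtc)//; apply: limr_le; first by apply/cvg_ex; eexists; exact: xtc.
near=> w; apply: H; apply/andP; split; near: w.
- exact: nbhs_left_gt.
- exact: nbhs_left_lt.
Unshelve. all: by end_near. Qed.

Lemma cadlag_right_near t e : 0 <= t < T -> 0 < e ->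
  exists2 d, 0 < d & forall w, t <= w < t + d -> `|x w - x t| <= e.
Proof.
move=> tT e0; case: xc => /(_ t tT) /cvgrPdist_le /(_ e e0) + _.
move=> /nbhs_ballP[d /= d0 H]; exists d => // w /andP[].
rewrite le_eqVlt => /predU1P[<- _|tw wd]; first by rewrite subrr normr0 ltW.
rewrite distrC; apply: H => //=.
by rewrite /ball /= ltr_distl; apply/andP; split; lra.
Qed.

Lemma cadlag_left_near t e : 0 < t <= T -> 0 < e ->
  exists2 d, 0 < d & forall w, t - d < w < t -> `|x w - left_limit x t| <= e.
Proof.
move=> tT e0; have /cvgrPdist_le /(_ e e0) := cadlag_left_cvg tT.
move=> /nbhs_ballP[d /= d0 H]; exists d => // w /andP[dw wt].
by rewrite distrC; apply: H => //=; rewrite /ball /= ltr_distl; apply/andP; split; lra.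
Qed.

(** The two one-sided limits at c in a form that covers both ends of [0, T]: at
    c = 0 the left part is void, at c = T the right part only speaks of T. *)
Lemma cadlag_local c e : 0 <= c <= T -> 0 < e ->
  exists d, [/\ 0 < d,
    forall s w, 0 <= s -> 0 <= w -> c - d < s < c -> c - d < w < c ->
      `|x s - x w| <= e &
    forall w, c <= w < c + d -> w <= T -> `|x w - x c| <= e].
Proof.
move=> /andP[c0 cT] e0.
have [dl dl0 Hl] : exists2 d, 0 < d & forall s w, 0 <= s -> 0 <= w ->
    c - d < s < c -> c - d < w < c -> `|x s - x w| <= e.
  have [c_gt0|c_le0] := ltP 0 c; last first.
    by exists 1 => // s w s0 w0 /andP[_ sc]; lra.
  have [||d d0 H] := @cadlag_left_near c (e / 2); first by rewrite c_gt0.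
    by rewrite divr_gt0.
  exists d => // s w _ _ /H sc /H wc.
  rewrite (le_trans (ler_distD (left_limit x c) _ _))// [e]splitr lerD//.
  by rewrite distrC.
have [dr dr0 Hr] : exists2 d, 0 < d & forall w, c <= w < c + d -> w <= T ->
    `|x w - x c| <= e.
  have [c_ltT|c_geT] := ltP c T; last first.
    exists 1 => // w /andP[cw _] wT; have -> : w = c by lra.
    by rewrite subrr normr0 ltW.
  have [|d d0 H] := @cadlag_right_near c e _ e0; first by rewrite c0.
  by exists d => // w /H.
exists (Num.min dl dr); split; first by rewrite lt_min dl0.
- move=> s w s0 w0 /andP[s1 s2] /andP[w1 w2]; apply: Hl => //.
    by rewrite s2 andbT (le_lt_trans _ s1)// lerB// ge_min lexx.
  by rewrite w2 andbT (le_lt_trans _ w1)// lerB// ge_min lexx.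
- move=> w /andP[w1 w2] wT; apply: Hr => //.
  by rewrite w1 (lt_le_trans w2)// lerD// ge_min lexx orbT.
Qed.

Hypothesis T0 : 0 < T.

(** A substitute for compactness of [0, T], for properties P t of the initial
    interval [0, t]. As s and t may be taken as close to c as needed, only the
    behaviour of x just before c, at c and just after c matters in a step. *)
Lemma initial_interval_chain (P : R -> Prop) : P 0 ->
  (forall c, 0 <= c <= T -> exists2 d, 0 < d & forall s t, 0 <= s -> t <= T ->
     c - d < s <= c -> c <= t < c + d -> P s -> P t) ->
  P T.
Proof.
move=> P0 step; suff [] : [set t | 0 <= t <= T /\ P t] T by [].
apply: (forward_chain (T := T)) => [t []//||c cT].
  by split => //; rewrite lexx ltW.
have [d d0 H] := step _ cT; exists d => // s [/andP[s0 sT] Ps] sc.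
have /andP[c0 c_leT] := cT.
have [c_ltT|c_geT] := ltP c T; last first.
  left; split; first by rewrite lexx ltW.
  by apply: (H s) => //; apply/andP; split; lra.
right; exists (Num.min (c + d / 2) T); last first.
  by rewrite lt_min c_ltT andbT ltrDl divr_gt0.
have tc : c <= Num.min (c + d / 2) T by rewrite le_min c_leT andbT; lra.
split; first by rewrite (le_trans c0 tc) ge_min lexx orbT.
apply: (H s) => //; first by rewrite ge_min lexx orbT.
by rewrite tc (@le_lt_trans _ _ (c + d / 2))// ?ge_min ?lexx//; lra.
Qed.

Lemma cadlag_bounded : exists2 M, 0 < M & forall t, 0 <= t <= T -> `|x t| <= M.
Proof.
suff [M H] : exists M, forall t, 0 <= t <= T -> `|x t| <= M.
  exists (`|M| + 1) => [|t /H xM]; first by rewrite ltr_wpDl.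
  by rewrite (le_trans xM)// (le_trans (ler_norm M))// lerDl.
apply: (initial_interval_chain
  (P := fun u => exists M, forall t, 0 <= t <= u -> `|x t| <= M)) => [|c cT].
  by exists `|x 0| => t t0; have -> : t = 0 by lra.
have [d [d0 Hl Hr]] := cadlag_local cT ltr01; exists d => // s t s0 tT sc ct [M H].
exists (`|M| + 1 + `|x c|) => w w0t.
have dist1 a b : `|x a - x b| <= 1 -> `|x a| <= 1 + `|x b|.
  move=> ab; rewrite -lerBlDr (le_trans _ ab)// (le_trans _ (lerB_dist _ _))//.
have nM := ler_norm M; have nM0 := normr_ge0 M; have nc := normr_ge0 (x c).
have [ws|sw] := leP w s.
  have := H w; have -> : 0 <= w <= s by lra.
  by move=> /(_ isT); lra.
have [wc|cw] := ltP w c.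
  have /dist1 : `|x w - x s| <= 1 by apply: Hl; lra.
  have := H s; have -> : 0 <= s <= s by lra.
  by move=> /(_ isT); lra.
have /dist1 : `|x w - x c| <= 1 by apply: Hr; lra.
lra.
Qed.

Lemma left_limit_bounded M t : (forall t, 0 <= t <= T -> `|x t| <= M) ->
  0 < t <= T -> `|left_limit x t| <= M.
Proof.
move=> H tT; rewrite -[left_limit _ _]subr0.
apply: (@left_limit_dist t 0) => // w wt; rewrite subr0; apply: H; lra.
Qed.

(** The one-sided limits at c leave no room for jumps of size e close to c, other
    than c itself. *)
Lemma jumps_ge_finite e : 0 < e -> finite_set (jumps_ge T x e).
Proof.
move=> e0; have -> : jumps_ge T x e = jumps_ge T x e `&` `[0, T].
  apply/seteqP; split=> [t|t []//] tJ; split=> //=.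
  by rewrite in_itv /=; case: tJ => /andP[/ltW -> ->].
apply: (initial_interval_chain
  (P := fun u => finite_set (jumps_ge T x e `&` `[0, u]))) => [|c cT].
  apply: (@sub_finite_set _ _ set0); last exact: finite_set0.
  by move=> t [[/andP[t0 _] _]] /=; rewrite in_itv /= => ?; lra.
have e40 : 0 < e / 4 by rewrite divr_gt0.
have [d [d0 Hl Hr]] := cadlag_local cT e40; exists d => // s t s0 tT sc ct fin.
apply: (@sub_finite_set _ _ ((jumps_ge T x e `&` `[0, s]) `|` [set c])); last first.
  by rewrite finite_setU; split=> //; exact: finite_set1.
move=> w [Jw /=]; rewrite in_itv /= => wt.
have [ws|sw] := leP w s; first by left; split=> //=; rewrite in_itv /=; lra.
right => /=; case: Jw => wT ew; apply/eqP; apply: contraT => wc.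
suff : `|jump x w| <= e / 2 by lra.
rewrite /jump distrC.
have [{}wc|cw|/eqP] := ltgtP w c; last by rewrite (negbTE wc).
  apply: (@left_limit_dist w s) => [|//|y ys]; first lra.
  by apply: le_trans (_ : e / 4 <= _); [apply: Hl; lra|lra].
apply: (@left_limit_dist w c) => [|//|y ys]; [lra|lra|].
rewrite (le_trans (ler_distD (x c) _ _))// (_ : e / 2 = e / 4 + e / 4); last by field.
by apply: lerD; [|rewrite distrC]; apply: Hr; lra.
Qed.

End Cadlag.

(** * Continuity points of monotone functions *)

(** A monotone function has countably many discontinuities, too few to fill an
    interval of positive length. *)
Lemma nondecreasing_continuity_point (R : realType) (F : R -> R) (a b : R) :
  a < b -> {in `[a, b] &, nondecreasing_fun F} ->
  exists2 t, a < t < b & F s @[s --> t] --> F t.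
Proof.
move=> ab ndF; apply: contrapT => noF.
suff /countable_lebesgue_measure0 : countable `]a, b[.
  rewrite lebesgue_measure_itv /= lte_fin ab => /eqP.
  by rewrite -EFinB eqe subr_eq0 gt_eqF.
apply: sub_countable (discontinuity_countable ndF); apply: subset_card_le.
move=> t tab; split; first by rewrite inE.
move: tab; rewrite /= in_itv /= => /andP[at_ tb].
have cl : cvg (F s @[s --> t^'-]).
  apply: nondecreasing_at_left_is_cvgr; near=> u.
    have au : a < u by near: u; exact: nbhs_left_gt.
    by move=> v w; rewrite !in_itv /= => vu wu vw; apply: ndF; rewrite ?in_itv //=; lra.
  have au : a < u by near: u; exact: nbhs_left_gt.
  exists (F t) => _ /= [v + <-]; rewrite in_itv /= => vu.
  by apply: ndF; rewrite ?in_itv /=; lra.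
have cr : cvg (F s @[s --> t^'+]).
  apply: nondecreasing_at_right_is_cvgr; near=> u.
    have ub : u < b by near: u; exact: nbhs_right_lt.
    by move=> v w; rewrite !in_itv /= => vu wu vw; apply: ndF; rewrite ?in_itv //=; lra.
  have ub : u < b by near: u; exact: nbhs_right_lt.
  exists (F t) => _ /= [v + <-]; rewrite in_itv /= => vu.
  by apply: ndF; rewrite ?in_itv /=; lra.
split => //; apply/eqP => lr; apply: noF; exists t; first by rewrite at_.
have lF : lim (F s @[s --> t^'-]) <= F t.
  apply: limr_le => //; near=> u.
  have au : a < u by near: u; exact: nbhs_left_gt.
  have ut : u < t by near: u; exact: nbhs_left_lt.
  by apply: ndF; rewrite ?in_itv /=; lra.
have rF : F t <= lim (F s @[s --> t^'+]).
  apply: limr_ge => //; near=> u.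
  have ub : u < b by near: u; exact: nbhs_right_lt.
  have tu : t < u by near: u; exact: nbhs_right_gt.
  by apply: ndF; rewrite ?in_itv /=; lra.
have e : lim (F s @[s --> t^'-]) = F t by apply/eqP; rewrite eq_le lF lr rF.
by apply/left_right_continuousP; split; [rewrite -e|rewrite -e lr].
Unshelve. all: by end_near. Qed.

(** * Intervals around a jump *)

Section Separation.
Variables (R : realType) (T : R) (x : R -> R) (pi : nat -> seq R).
Hypothesis xc : cadlag T x.
Hypothesis piT : forall n, itv_partition 0 T (pi n).
Hypothesis left_endpoint_cvg : forall s : R, 0 < s <= T ->
  x (lower_endpoint (pi n) s) @[n --> \oo] --> left_limit x s.
Implicit Types s t : R.

Lemma lower_endpointE (p : seq R) s : lower_endpoint p s = (interval_at p s).1.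
Proof. by []. Qed.

(** If the interval around a jump time s extended past s by a fixed amount, it
    would contain a time t slightly after s, and x at the common left endpoint
    would have to be close to both x(s-) and x(t-), while x(t-) is near x(s). *)
Lemma jump_interval_shrinks s t : 0 < s <= T -> jump x s != 0 -> s < t ->
  \forall n \near \oo, (interval_at (pi n) s).2 < t.
Proof.
move=> sT Js st.
have [s_ltT|s_geT] := ltP s T; last first.
  near=> n; have [/(interval_bounds (piT n))[_ _ h] _] := interval_atP (piT n) sT.
  by rewrite (le_lt_trans h)//; lra.
have J0 : 0 < `|jump x s| / 4 by rewrite divr_gt0// normr_gt0.
have [|d d0 Hd] := @cadlag_right_near _ T x xc s _ _ J0; first by rewrite s_ltT andbT; lra.
have [u [su uT ut ud]] : exists u, [/\ s < u, u <= T, u <= t & u <= s + d].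
  exists (Num.min T (Num.min t (s + d))).
  by rewrite !lt_min !ge_min s_ltT st ltrDl d0 !lexx !orbT.
have uT' : 0 < u <= T by lra.
have xu : `|left_limit x u - x s| <= `|jump x s| / 4.
  apply: (@left_limit_dist _ T x xc u s) => [||w wu]; [lra|lra|].
  by apply: Hd; lra.
have /cvgr_dist_lt /(_ _ J0) ns := left_endpoint_cvg sT.
have /cvgr_dist_lt /(_ _ J0) nu := left_endpoint_cvg uT'.
near=> n; rewrite (lt_le_trans _ ut)// ltNge; apply/negP => ule.
have [sp sc] := interval_atP (piT n) sT.
have su_eq : interval_at (pi n) s = interval_at (pi n) u.
  apply: (interval_at_unique (piT n) uT' sp).
  by move: sc; rewrite /contains; lra.
have Hs : `|left_limit x s - x (lower_endpoint (pi n) s)| < `|jump x s| / 4.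
  by near: n.
have : `|left_limit x u - x (lower_endpoint (pi n) u)| < `|jump x s| / 4.
  by near: n.
rewrite [lower_endpoint _ u]lower_endpointE -su_eq -lower_endpointE => Hu.
suff : `|jump x s| <= `|jump x s| / 4 * 3 by lra.
move: Hs Hu xu; set j := `|jump x s| / 4; rewrite !ltr_norml !ler_norml /jump; lra.
Unshelve. all: by end_near. Qed.

(** Right-continuity, once the interval has shrunk to s. The case t = T covers
    s = T, where the right endpoint is T itself. *)
Lemma jump_right_endpoint_cvg s t : 0 < s <= T -> jump x s != 0 -> s < t \/ t = T ->
  x (Num.min (interval_at (pi n) s).2 t) @[n --> \oo] --> x s.
Proof.
move=> sT Js st; apply/cvgrPdist_le => e e0.
have [s_ltT|s_geT] := ltP s T; last first.
  have sE : s = T by lra.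
  near=> n; have [/(interval_bounds (piT n))[_ _ h] c] := interval_atP (piT n) sT.
  suff -> : Num.min (interval_at (pi n) s).2 t = s by rewrite subrr normr0 ltW.
  have : s <= t by lra.
  by move: c; rewrite /contains => /andP[_ c] ?; apply/le_anti; rewrite le_min ge_min c; lra.
have [|d d0 Hd] := @cadlag_right_near _ T x xc s _ _ e0; first by rewrite s_ltT andbT; lra.
have sd : s < s + d by rewrite ltrDl.
have ns := jump_interval_shrinks sT Js sd.
near=> n; rewrite distrC; apply: Hd.
have [_] := interval_atP (piT n) sT; rewrite /contains => /andP[_ c].
have st' : s <= t by lra.
by rewrite le_min c st' gt_min; apply/orP; left; near: n.
Unshelve. all: by end_near. Qed.

(** The interval around the earlier jump eventually ends before the later one. *)
Lemma jump_intervals_distinct s t : 0 < s <= T -> 0 < t <= T ->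
  jump x s != 0 -> jump x t != 0 -> s != t ->
  \forall n \near \oo, interval_at (pi n) s != interval_at (pi n) t.
Proof.
wlog st : s t / s < t => [wl sT tT Js Jt|sT tT Js Jt _].
  rewrite neq_lt => /orP[st|ts]; first by apply: wl; rewrite // lt_eqF.
  have := wl t s ts tT sT Jt Js; rewrite (lt_eqF ts) => /(_ isT).
  by apply: filterS => n; rewrite eq_sym.
have := jump_interval_shrinks sT Js st; apply: filterS => n h.
have [_ /andP[_ h']] := interval_atP (piT n) tT.
by apply/eqP => e; rewrite e in h; lra.
Qed.

End Separation.

(** * Weighted quadratic sums *)

Section WeightedQuadraticSum.
Variables (R : realType) (T : R) (x : R -> R) (pi : nat -> seq R).
Hypothesis T0 : 0 < T.
Hypothesis xc : cadlag T x.
Hypothesis piT : forall n, itv_partition 0 T (pi n).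
Hypothesis left_endpoint_cvg : forall s : R, 0 < s <= T ->
  x (lower_endpoint (pi n) s) @[n --> \oo] --> left_limit x s.
Variable phi : R -> R.
Hypothesis phi_cont : continuous phi.
Implicit Types (s t e eta : R).

Definition stopped_square (uv : R * R) t : R :=
  (x (Num.min uv.2 t) - x (Num.min uv.1 t)) ^+ 2.

Definition weighted_sum (p : seq R) t : R :=
  \sum_(uv <- intervals p) phi (x uv.1) * stopped_square uv t.

Lemma cadlag_comp : cadlag T (phi \o x).
Proof.
case: xc => xr xl; split => t tT.
  by apply: (cvg_comp _ _ (xr t tT)); exact: phi_cont.
by apply/cvg_ex; exists (phi (left_limit x t));
  apply: (cvg_comp _ _ (cadlag_left_cvg xc tT)); exact: phi_cont.
Qed.

Lemma left_limit_comp t : 0 < t <= T ->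
  left_limit (phi \o x) t = phi (left_limit x t).
Proof.
move=> tT; apply/cvg_lim => //.
by apply: (cvg_comp _ _ (cadlag_left_cvg xc tT)); exact: phi_cont.
Qed.

Let increment s t uv := stopped_square uv t - stopped_square uv s.

(** Away from the interval that straddles s, a stopped square only changes between
    the times s and t if its interval starts in [s, t), and then it grows from 0. *)
Lemma weighted_increment_le p s t eta : itv_partition 0 T p ->
  0 <= s -> s <= t -> t <= T ->
  (forall u, s <= u < t -> `|phi (x u) - phi (x s)| <= eta) ->
  `|weighted_sum p t - weighted_sum p s
    - phi (x s) * (quadratic_sum x p t - quadratic_sum x p s)|
  <= eta * (quadratic_sum x p t - quadratic_sum x p s)
     + \sum_(uv <- intervals p | contains s uv)
        (`|phi (x uv.1) - phi (x s)| * `|increment s t uv| - eta * increment s t uv).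
Proof.
move=> pT s0 st tT H.
have -> : quadratic_sum x p t - quadratic_sum x p s =
    \sum_(uv <- intervals p) increment s t uv by rewrite -sumrB.
rewrite -sumrB !mulr_sumr -sumrB (le_trans (ler_norm_sum _ _ _))//.
rewrite [X in _ + X]big_mkcond -big_split /= big_seq [leRHS]big_seq.
apply: ler_sum => uv /(interval_bounds pT)[u0 uv_lt vT].
have -> : phi (x uv.1) * stopped_square uv t - phi (x uv.1) * stopped_square uv s -
   phi (x s) * increment s t uv = (phi (x uv.1) - phi (x s)) * increment s t uv.
  by rewrite /increment; ring.
rewrite normrM; case: ifPn => [_|]; first by rewrite addrC subrK.
rewrite /contains negb_and -leNgt -ltNge addr0 => /orP[su|vs].
  have e : stopped_square uv s = 0.
    have h1 : s <= uv.2 by lra.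
    by rewrite /stopped_square (min_r su) (min_r h1) subrr expr0n.
  rewrite /increment e subr0 [X in _ * X]ger0_norm ?sqr_ge0//.
  have [ut|tu] := ltP uv.1 t; first by rewrite ler_wpM2r ?sqr_ge0// H ?su.
  have h1 : t <= uv.2 by lra.
  by rewrite /stopped_square (min_r tu) (min_r h1) subrr expr0n /= !mulr0.
have -> : increment s t uv = 0; last by rewrite normr0 !mulr0.
have [h1 h2 h3 h4] : [/\ uv.2 <= s, uv.1 <= s, uv.2 <= t & uv.1 <= t] by split; lra.
by rewrite /increment /stopped_square !min_l // subrr.
Qed.

(** At a jump time s the straddling interval shrinks to s, so its squared
    increment does not change between s and t in the limit. At other times it may
    stay large, but then the value of x at its left endpoint tends to x(s), so
    that it gets the weight phi(x(s)) in the limit. *)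
Lemma straddling_error_le s t eta e : 0 <= s -> s < t -> t <= T -> 0 <= eta ->
  0 < e -> \forall n \near \oo,
    \sum_(uv <- intervals (pi n) | contains s uv)
        (`|phi (x uv.1) - phi (x s)| * `|increment s t uv| - eta * increment s t uv)
    <= e.
Proof.
move=> s0 st tT eta0 e0.
have [s_le0|s_gt0] := leP s 0.
  near=> n; rewrite big_seq_cond big1 ?ltW// => uv /andP[/(interval_bounds (piT n))[u0 _ _]].
  by rewrite /contains; lra.
have sT : 0 < s <= T by lra.
pose a n := x (lower_endpoint (pi n) s).
pose b n := x (Num.min (interval_at (pi n) s).2 t).
pose D n := (b n - a n) ^+ 2 - (x s - a n) ^+ 2.
suff : \forall n \near \oo, `|phi (a n) - phi (x s)| * `|D n| - eta * D n <= e.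
  apply: filterS => n; rewrite (sum_contains _ (piT n) sT) /D /a /b.
  rewrite lower_endpointE /increment /stopped_square.
  have [_ /andP[us sv]] := interval_atP (piT n) sT.
  by rewrite (min_r sv) (min_l (ltW us)) (min_l (ltW (lt_trans us st))).
have acvg : a n @[n --> \oo] --> left_limit x s by exact: left_endpoint_cvg.
have phia : phi (a n) @[n --> \oo] --> phi (left_limit x s).
  by apply: (cvg_comp _ _ acvg); exact: phi_cont.
have [Js|Js] := eqVneq (jump x s) 0; last first.
  have bcvg : b n @[n --> \oo] --> x s.
    by apply: (jump_right_endpoint_cvg xc piT left_endpoint_cvg) => //; left.
  have Dcvg : D n @[n --> \oo] --> (x s - left_limit x s) ^+ 2 - (x s - left_limit x s) ^+ 2.
    by apply: cvgB; (apply: cvgM; apply: cvgB => //); exact: cvg_cst.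
  rewrite subrr in Dcvg.
  have : `|phi (a n) - phi (x s)| * `|D n| - eta * D n @[n --> \oo] -->
      `|phi (left_limit x s) - phi (x s)| * `|0 : R| - eta * 0.
    apply: cvgB; last by apply: cvgM => //; exact: cvg_cst.
    apply: cvgM; last exact: cvg_norm.
    by apply: cvg_norm; apply: cvgB => //; exact: cvg_cst.
  by rewrite normr0 !mulr0 subrr => /cvgr_le; apply.
have xs : left_limit x s = x s by move/eqP: Js; rewrite /jump subr_eq0 => /eqP.
rewrite xs in acvg phia.
have [M M0 xM] := cadlag_bounded xc T0.
have : `|phi (a n) - phi (x s)| * (8 * M ^+ 2) + eta * (x s - a n) ^+ 2 @[n --> \oo] -->
    `|phi (x s) - phi (x s)| * (8 * M ^+ 2) + eta * (x s - x s) ^+ 2.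
  apply: cvgD.
    apply: cvgM; last exact: cvg_cst.
    by apply: cvg_norm; apply: cvgB => //; exact: cvg_cst.
  apply: cvgM; first exact: cvg_cst.
  by apply: cvgM; apply: cvgB => //; exact: cvg_cst.
rewrite !subrr normr0 expr0n /= mul0r mulr0 addr0 => /cvgr_le /(_ e e0).
apply: filterS => n; apply: le_trans.
have sq_le y z : `|y| <= M -> `|z| <= M -> (y - z) ^+ 2 <= 4 * M ^+ 2.
  move=> yM zM; rewrite -real_normK ?num_real// (_ : 4 * M ^+ 2 = (M + M) ^+ 2); last by ring.
  by rewrite lerXn2r ?nnegrE ?addr_ge0 ?(ltW M0)// (le_trans (ler_normB _ _))// lerD.
have [uvp /andP[us sv]] := interval_atP (piT n) sT.
have [u0 uv vT] := interval_bounds (piT n) uvp.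
have aM : `|a n| <= M by apply: xM; rewrite lower_endpointE; lra.
have bM : `|b n| <= M by apply: xM; rewrite le_min ge_min; lra.
have sM : `|x s| <= M by apply: xM; lra.
have := sq_le _ _ bM aM; have := sq_le _ _ sM aM.
have := sqr_ge0 (b n - a n); have := sqr_ge0 (x s - a n).
rewrite /D; move: ((b n - a n) ^+ 2) ((x s - a n) ^+ 2) => p q q0 p0 q4 p4.
(* p and q lie in [0, 4 M^2], and q - p <= q. *)
apply: lerD; first by rewrite ler_wpM2l// ler_norml; lra.
by rewrite -mulrN ler_wpM2l//; lra.
Unshelve. all: by end_near. Qed.

(** A form of convergence up to a relative error eta that is additive in time:
    the error allowed over [0, t] is the one over [0, s] plus eta times the growth
    of the quadratic sum. *)
Definition nearly_convergent eta t : Prop :=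
  exists2 c : nat -> R, cvgn c &
    forall e, 0 < e -> \forall n \near \oo,
      `|weighted_sum (pi n) t - c n| <= eta * quadratic_sum x (pi n) t + e.

(** The convergent sequence at t adds phi(x(s)) times the growth of the quadratic
    sums to the one at s. *)
Lemma nearly_convergent_step eta s t : 0 <= eta -> 0 <= s -> s < t -> t <= T ->
  (forall u, s <= u < t -> `|phi (x u) - phi (x s)| <= eta) ->
  cvgn (fun n => quadratic_sum x (pi n) s) ->
  cvgn (fun n => quadratic_sum x (pi n) t) ->
  nearly_convergent eta s -> nearly_convergent eta t.
Proof.
move=> eta0 s0 st tT osc cs ct [c cc H].
exists (fun n => c n + phi (x s) * (quadratic_sum x (pi n) t - quadratic_sum x (pi n) s)).
  apply: is_cvgD => //; apply: is_cvgM; first exact: is_cvg_cst.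
  exact: is_cvgB.
move=> e e0; have e20 : 0 < e / 2 by rewrite divr_gt0.
have := straddling_error_le s0 st tT eta0 e20.
apply: filterS2 (H _ e20) => n Hn err.
have inc := weighted_increment_le (piT n) s0 (ltW st) tT osc.
move: Hn inc err; move: (weighted_sum _ s) (weighted_sum _ t) => Ss St.
move: (quadratic_sum x _ s) (quadratic_sum x _ t) => Qs Qt.
move: (\sum_(_ <- _ | _) _) => E; move: (phi (x s) * (Qt - Qs)) => P.
by rewrite !mulrBr !ler_norml; lra.
Qed.

End WeightedQuadraticSum.

Section WeightedSumConvergence.
Variables (R : realType) (T : R) (x : R -> R) (pi : nat -> seq R).
Hypothesis T0 : 0 < T.
Hypothesis xc : cadlag T x.
Hypothesis piT : forall n, itv_partition 0 T (pi n).
Hypothesis left_endpoint_cvg : forall s : R, 0 < s <= T ->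
  x (lower_endpoint (pi n) s) @[n --> \oo] --> left_limit x s.
Variable phi : R -> R.
Hypothesis phi_cont : continuous phi.

Let good t := cvgn (fun n => quadratic_sum x (pi n) t).
Hypothesis good_T : good T.
Hypothesis good_jump : forall t, 0 < t <= T -> jump x t != 0 -> good t.
Hypothesis good_dense : forall a b, 0 <= a -> a < b -> b <= T ->
  exists2 t, a < t < b & good t.

(** The set A of reached times gets past every c. If c is a jump time or T, the
    step lands on c first and continues from there, because phi \o x varies little
    only on [s, c) and on [c, t). Otherwise c may fail to be a time at which the
    quadratic sums converge, but then phi \o x is continuous at c and one step
    leads across c. *)
Lemma nearly_convergent_T eta : 0 < eta -> nearly_convergent x pi phi eta T.
Proof.
move=> eta0.
pose A := [set t | [/\ 0 <= t <= T, good t & nearly_convergent x pi phi eta t]].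
suff [] : A T by [].
have step s t : A s -> s < t -> t <= T -> good t ->
    (forall u, s <= u < t -> `|phi (x u) - phi (x s)| <= eta) -> A t.
  move=> [/andP[s0 sT] gs ns] st tT gt osc; split=> //.
    by rewrite tT (ltW (le_lt_trans s0 st)).
  by apply: (nearly_convergent_step T0 xc piT left_endpoint_cvg phi_cont _ s0 st)
    => //; exact: ltW.
have sum0 (w : R * R -> R) n :
    \sum_(uv <- intervals (pi n)) w uv * stopped_square x uv 0 = 0.
  rewrite big_seq big1// => uv /(interval_bounds (piT n))[u0 uv_lt _].
  have v0 : 0 <= uv.2 by lra.
  by rewrite /stopped_square (min_r u0) (min_r v0) subrr expr0n mulr0.
have Q0 n : quadratic_sum x (pi n) 0 = 0.
  by rewrite -[RHS](sum0 (fun=> 1) n); apply: eq_bigr => uv _; rewrite mul1r.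
apply: (forward_chain (T := T)) => [t []//||c cT].
  split; [by rewrite lexx ltW| |].
    by rewrite /good; under eq_fun do rewrite Q0; exact: is_cvg_cst.
  exists (fun=> 0); first exact: is_cvg_cst.
  move=> e e0; near=> n.
  by rewrite Q0 /weighted_sum sum0 subrr normr0 mulr0 add0r ltW.
have e0 : 0 < eta / 2 by rewrite divr_gt0.
have [d [d0 Hl Hr]] := cadlag_local (cadlag_comp xc phi_cont) cT e0.
exists d => // s As sc.
have s0T : 0 <= s <= T by case: As.
(* Either c itself is reached, or x has no jump at c, c < T and phi \o x varies
   little on both sides of c. *)
have [Ac|[s_ltc c_ltT Jc]] : A c \/ [/\ s < c, c < T & jump x c = 0].
  have [s_ltc|s_gec] := ltP s c; last first.
    by left; suff -> : c = s by []; lra.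
  have reach : good c -> A c.
    move=> gc; apply: (step s) => //; first lra.
    by move=> u su; rewrite (le_trans (Hl u s _ _ _ _)); lra.
  have [c_ltT|c_geT] := ltP c T; last first.
    by left; apply: reach; suff -> : c = T by []; lra.
  have [Jc|Jc] := eqVneq (jump x c) 0; first by right.
  by left; apply: reach; apply: good_jump => //; lra.
- have [c_ltT|c_geT] := ltP c T; last by left; suff <- : c = T by []; lra.
  right; have [|||t tcd gt] := @good_dense c (Num.min (c + d) T).
  + by lra.
  + by rewrite lt_min c_ltT andbT ltrDl.
  + by rewrite ge_min lexx orbT.
  move: tcd; rewrite lt_min => /andP[ct /andP[tcd tT]].
  exists t => //; apply: (step c) => //; first exact: ltW.
  by move=> u uct; rewrite (le_trans (Hr u _ _)); lra.
- right; have [|||t tcd gt] := @good_dense c (Num.min (c + d) T).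
  + by lra.
  + by rewrite lt_min c_ltT andbT ltrDl.
  + by rewrite ge_min lexx orbT.
  move: tcd; rewrite lt_min => /andP[ct /andP[tcd tT]].
  exists t => //; apply: (step s) => //; [lra|exact: ltW|].
  have c0T : 0 < c <= T by lra.
  have cs : `|phi (x c) - phi (x s)| <= eta / 2.
    have -> : phi (x c) = left_limit (phi \o x) c.
      rewrite (left_limit_comp xc phi_cont c0T); congr phi; apply/eqP.
      by rewrite -subr_eq0 -/(jump x c) Jc.
    apply: (left_limit_dist (cadlag_comp xc phi_cont) (a := s)); [lra|lra|].
    by move=> w ws; apply: Hl; lra.
  move=> u ust; have [uc|cu] := ltP u c.
    by rewrite (le_trans (Hl u s _ _ _ _)); lra.
  rewrite (le_trans (ler_distD (phi (x c)) _ _))// [leRHS]splitr lerD//.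
  by apply: Hr; lra.
Unshelve. all: by end_near. Qed.

Lemma weighted_sum_cvg : cvgn (fun n => weighted_sum x phi (pi n) T).
Proof.
apply: cauchy_cvg; apply: cauchy_exP => e e0.
have /cvg_ex[q Qq] := good_T.
have q0 : 0 <= q.
  rewrite -(cvg_lim _ Qq)//; apply: limr_ge => //; near=> n.
  by apply: sumr_ge0 => uv _; exact: sqr_ge0.
have e40 : 0 < e / 4 by rewrite divr_gt0.
have eta0 : 0 < e / 4 / (q + 1) by rewrite divr_gt0// ltr_wpDl.
have [c /cvg_ex[l cl] H] := nearly_convergent_T eta0.
have /cvgr_le /(_ (q + 1)) := Qq; rewrite ltrDl ltr01 => /(_ isT) Qle.
have /cvgr_dist_le /(_ _ e40) cle := cl.
exists l; suff : \forall n \near \oo, `|l - weighted_sum x phi (pi n) T| < e by [].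
near=> n.
have Sn : `|weighted_sum x phi (pi n) T - c n| <=
    e / 4 / (q + 1) * quadratic_sum x (pi n) T + e / 4.
  by near: n; exact: H.
have Qn : quadratic_sum x (pi n) T <= q + 1 by near: n.
have cn : `|l - c n| <= e / 4 by near: n.
have : e / 4 / (q + 1) * quadratic_sum x (pi n) T <= e / 4.
  rewrite -[leRHS](@divfK _ (q + 1)) ?lt0r_neq0 ?ltr_wpDl//.
  by rewrite ler_wpM2l// ltW.
move: Sn cn; rewrite !ler_norml ltr_norml; lra.
Unshelve. all: by end_near. Qed.

End WeightedSumConvergence.

(** * Second-order Taylor remainder *)

Lemma half_distance_le (R : realFieldType) (p q s : R) :
  `|p| <= s -> `|q| <= s -> 2^-1 * `|p - q| <= s.
Proof. by move=> ps qs; have := ler_normB p q; lra. Qed.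

Section Taylor.
Variables (R : realType) (f : R -> R).
Hypothesis f_C2 : twice_continuously_differentiable f.
Implicit Types (a b e M : R).

(** For a = x(t-) and b = x(t) this is the term of the series J at t. *)
Definition taylor_remainder a b : R :=
  f b - f a - derive1 f a * (b - a) - 2^-1 * derive1n 2 f a * (b - a) ^+ 2.

Let is_derive_f a : is_derive a 1 f (derive1 f a).
Proof. by case: f_C2 => + _ _ => /(_ a)/derivableP; rewrite derive1E. Qed.

Let is_derive_f' a : is_derive a 1 (derive1 f) (derive1n 2 f a).
Proof.
by case: f_C2 => _ + _ => /(_ a)/derivableP; rewrite -derive1E.
Qed.

(** Rolle's theorem for t |-> f b - f t - f'(t) (b - t) - K (b - t)^2, with K
    chosen so that this function vanishes at a as well as at b. *)
Lemma taylor2_lagrange a b : a != b ->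
  exists2 c, Num.min a b <= c <= Num.max a b &
    f b - f a - derive1 f a * (b - a) = 2^-1 * derive1n 2 f c * (b - a) ^+ 2.
Proof.
move=> ab; have ba0 : b - a != 0 by rewrite subr_eq0 eq_sym.
pose K := (f b - f a - derive1 f a * (b - a)) / (b - a) ^+ 2.
pose h t := f b - f t - derive1 f t * (b - t) - K * (b - t) ^+ 2.
have dh (t : R) : is_derive t 1 h ((2 * K - derive1n 2 f t) * (b - t)).
  have -> : h = cst (f b) - f - derive1 f * (cst b - id) -
      cst K * (cst b - id) ^+ 2 by apply/funext.
  have d1 : is_derive t 1 (cst b - id : R -> R) (0 - 1) by apply: is_deriveB.
  have d2 := is_deriveM (is_derive_f' t) d1.
  have d3 := is_deriveX 2 d1.
  have d4 := is_deriveM (is_derive_cst K t 1) d3.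
  have d5 := is_deriveB (is_derive_cst (f b) t 1) (is_derive_f t).
  apply: (is_derive_eq (is_deriveB (is_deriveB d5 d2) d4)).
  by rewrite /GRing.scale /= !fctE /=; ring.
have ha : h a = 0 by rewrite /h /K divfK ?expf_neq0// subrr.
have hb : h b = 0 by rewrite /h !subrr expr0n /= !mulr0 !subr0.
have [c cab hc] : exists2 c, Num.min a b < c < Num.max a b & is_derive c 1 h 0.
  have [||||c] := @Rolle R h (Num.min a b) (Num.max a b).
  - by rewrite gt_min !lt_max !ltxx orbF /= -neq_lt.
  - by move=> t _; have [] := dh t.
  - by apply: derivable_within_continuous => t _; have [] := dh t.
  - by rewrite /Num.min /Num.max; case: ifP => _; rewrite ha hb.
  by rewrite in_itv /=; exists c.
have : (2 * K - derive1n 2 f c) * (b - c) = 0.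
  by rewrite -(@derive_val _ _ _ _ _ _ _ (dh c)) (@derive_val _ _ _ _ _ _ _ hc).
move=> /eqP; rewrite mulf_eq0 => /orP[/eqP Kc|/eqP bc]; last first.
  have cb : c = b by lra.
  move: cab; rewrite cb gt_min lt_max ltxx !orbF => /andP[ab' ba'].
  by have := lt_trans ab' ba'; rewrite ltxx.
exists c; first by case/andP: cab => /ltW -> /ltW ->.
have -> : 2^-1 * derive1n 2 f c = K by lra.
by rewrite /K divfK// expf_neq0.
Qed.

Lemma taylor_remainderE a b : exists2 c, Num.min a b <= c <= Num.max a b &
  taylor_remainder a b = 2^-1 * (derive1n 2 f c - derive1n 2 f a) * (b - a) ^+ 2.
Proof.
have [->|/taylor2_lagrange[c cab E]] := eqVneq a b; last first.
  by exists c => //; rewrite /taylor_remainder E -mulrBl -mulrBr.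
exists b; first by rewrite ge_min le_max lexx.
by rewrite /taylor_remainder !subrr; ring.
Qed.

Lemma taylor_remainder_bounded M : exists2 C, 0 <= C & forall a b,
  `|a| <= M -> `|b| <= M -> `|taylor_remainder a b| <= C * (b - a) ^+ 2.
Proof.
have [M0|M0] := ltP M 0.
  by exists 0 => // a b aM; have := normr_ge0 a; lra.
have [||m _ mH] := @EVT_max R (fun t => `|derive1n 2 f t|) (- M) M; first lra.
  apply: continuous_subspaceT => t; apply: continuous_comp; last exact: norm_continuous.
  by case: f_C2 => _ _; apply.
exists `|derive1n 2 f m| => // a b aM bM.
have [c cab ->] := taylor_remainderE a b.
rewrite normrM [X in _ * X]ger0_norm ?sqr_ge0// ler_wpM2r ?sqr_ge0//.
rewrite normrM ger0_norm ?invr_ge0//.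
have bound t : `|t| <= M -> `|derive1n 2 f t| <= `|derive1n 2 f m|.
  by move=> tM; apply: mH; rewrite in_itv /= -ler_norml.
have cM : `|c| <= M.
  move: cab aM bM; rewrite !ler_norml ge_min le_max; lra.
exact: half_distance_le (bound c cM) (bound a aM).
Qed.

(** Uniform continuity of f'' on [-M, M], applied to the intermediate point of
    the Lagrange form. *)
Lemma taylor_remainder_small M e : 0 < e -> exists2 d, 0 < d & forall a b,
  `|a| <= M -> `|b| <= M -> `|b - a| <= d ->
  `|taylor_remainder a b| <= e * (b - a) ^+ 2.
Proof.
move=> e0.
have e20 : 0 < e / 2 by rewrite divr_gt0.
have cpt : near_covering [set` `[- M, M]].
  by apply/compact_near_coveringP; exact: segment_compact.
have /nbhs_ballP[d /= d0 unif] : \forall d \near (0 : R)^'+, [set` `[- M, M]] `<=`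
    [set a | forall c, `|c - a| <= d -> `|derive1n 2 f c - derive1n 2 f a| <= e].
  apply: cpt => a _; case: f_C2 => _ _ /(_ a) /cvgrPdist_le /(_ _ e20).
  move=> /nbhs_ballP[r /= r0 H]; have r20 : 0 < r / 2 by rewrite divr_gt0.
  exists (ball a (r / 2), [set d | d < r / 2]) => /=.
    by split; [exact: nbhsx_ballx|exact: nbhs_right_lt].
  move=> [b d] /= [ab dr] c cb.
  rewrite (le_trans (ler_distD (derive1n 2 f a) _ _))// [leRHS]splitr lerD//.
    rewrite distrC; apply: H; rewrite /ball /=.
    move: ab cb; rewrite /ball /= ler_norml !ltr_norml; lra.
  by apply: H; rewrite /ball /=; move: ab; rewrite /ball /= !ltr_norml; lra.
exists (d / 2); first by rewrite divr_gt0.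
move=> a b aM bM ab; have [c cab ->] := taylor_remainderE a b.
rewrite normrM [X in _ * X]ger0_norm ?sqr_ge0// ler_wpM2r ?sqr_ge0//.
rewrite normrM ger0_norm ?invr_ge0//.
suff : `|derive1n 2 f c - derive1n 2 f a| <= e by lra.
apply: (unif (d / 2)) => /=.
- by rewrite /ball /= sub0r normrN ger0_norm; lra.
- by rewrite divr_gt0.
- by rewrite in_itv /= -ler_norml.
- move: cab ab; rewrite !ler_norml ge_min le_max; lra.
Qed.

Lemma taylor_remainder_cvg (u v : nat -> R) a b :
  u n @[n --> \oo] --> a -> v n @[n --> \oo] --> b ->
  taylor_remainder (u n) (v n) @[n --> \oo] --> taylor_remainder a b.
Proof.
have [df ddf cf''] := f_C2.
have cf c : {for c, continuous f} by exact/differentiable_continuous/derivable1_diffP.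
have cf' c : {for c, continuous (derive1 f)}.
  exact/differentiable_continuous/derivable1_diffP.
move=> ua vb.
have vu : v n - u n @[n --> \oo] --> b - a by exact: cvgB.
have fu : f (u n) @[n --> \oo] --> f a by apply: (cvg_comp _ _ ua); exact: cf.
have fv : f (v n) @[n --> \oo] --> f b by apply: (cvg_comp _ _ vb); exact: cf.
have f'u : derive1 f (u n) @[n --> \oo] --> derive1 f a.
  by apply: (cvg_comp _ _ ua); exact: cf'.
have f''u : derive1n 2 f (u n) @[n --> \oo] --> derive1n 2 f a.
  by apply: (cvg_comp _ _ ua); exact: cf''.
apply: cvgB; last first.
  by apply: cvgM; [apply: cvgM => //; exact: cvg_cst|exact: cvgM].
by apply: cvgB; [exact: cvgB|exact: cvgM].
Qed.

End Taylor.

(** * Finite approximation of unordered sums *)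

Section UnorderedSum.
Variables (R : realType) (D : set R).
Implicit Types (h g : R -> R) (F : set R).

Lemma esum_approx h e : (forall t, 0 <= h t) ->
  (\esum_(t in D) (h t)%:E < +oo)%E -> 0 < e ->
  exists2 F0, fsets D F0 & forall F, fsets D F -> F0 `<=` F ->
    fine (\esum_(t in D) (h t)%:E)%E - e <= \sum_(s <- fset_set F) h s
      <= fine (\esum_(t in D) (h t)%:E)%E.
Proof.
move=> h0 hoo e0; have hE F : finite_set F ->
    (\sum_(t \in F) (h t)%:E = (\sum_(s <- fset_set F) h s)%:E)%E.
  by move=> fF; rewrite fsbig_finite//= sumEFin.
have hfin : (\esum_(t in D) (h t)%:E \is a fin_num)%E.
  by rewrite ge0_fin_numE//; apply: esum_ge0 => t _; rewrite lee_fin.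
have [_ [F0 F0D <-] F0e] := ub_ereal_sup_adherent e0 hfin.
exists F0 => // F [fF FD] F0F; apply/andP; split.
  rewrite -lee_fin EFinB fineK// (le_trans (ltW F0e))// -hE//.
  apply: lee_fsum_nneg_subset => //; first by case: F0D.
    exact/subsetP.
  by move=> t _; rewrite lee_fin.
rewrite -lee_fin fineK// -hE//; apply: ereal_sup_ubound.
by exists F.
Qed.

(** The positive and the negative part are approximated separately; adding more
    indices keeps both approximations, so F can be made to contain F0. *)
Lemma unordered_sum_approx g F0 e : summable D (EFin \o g) -> fsets D F0 -> 0 < e ->
  exists2 F, fsets D F /\ F0 `<=` F &
    `|\sum_(s <- fset_set F) g s - unordered_sum D g| <= e.
Proof.
move=> gD [fF0 F0D] e0; have e20 : 0 < e / 2 by rewrite divr_gt0.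
have posE : (EFin \o g)^\+%E = fun t => (Num.max (g t) 0)%:E.
  by apply/funext => t; rewrite funeposE /= EFin_max.
have negE : (EFin \o g)^\-%E = fun t => (Num.max (- g t) 0)%:E.
  by apply/funext => t; rewrite funenegE /= EFin_max.
have poo := summable_funepos gD; have noo := summable_funeneg gD.
have nnabs (h : R -> \bar R) : (forall t, 0 <= h t)%E ->
    (\esum_(t in D) `|h t| = \esum_(t in D) h t)%E.
  by move=> h0; apply: eq_esum => t _; rewrite gee0_abs.
move: poo noo; rewrite /summable !nnabs => [|t|t]; [|exact: funeneg_ge0|exact: funepos_ge0].
rewrite posE negE => poo noo.
have max0 (r : R) : 0 <= Num.max r 0 by rewrite le_max lexx orbT.
have [F1 [fF1 F1D] H1] := esum_approx (fun t => max0 (g t)) poo e20.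
have [F2 [fF2 F2D] H2] := esum_approx (fun t => max0 (- g t)) noo e20.
have FD : fsets D (F0 `|` F1 `|` F2).
  split; first by rewrite !finite_setU.
  by move=> t [[/F0D|/F1D]|/F2D].
exists (F0 `|` F1 `|` F2); first by split=> // t F0t; left; left.
have /H1-/(_ FD)h1 : F1 `<=` F0 `|` F1 `|` F2 by move=> t F1t; left; right.
have /H2-/(_ FD)h2 : F2 `<=` F0 `|` F1 `|` F2 by move=> t F2t; right.
have fin (h : R -> R) : (forall t, 0 <= h t) ->
    (\esum_(t in D) (h t)%:E < +oo -> \esum_(t in D) (h t)%:E \is a fin_num)%E.
  by move=> h0; rewrite ge0_fin_numE//; apply: esum_ge0 => t _; rewrite lee_fin.
rewrite /unordered_sum posE negE fineB; [|exact: fin|exact: fin].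
have -> : \sum_(s <- fset_set (F0 `|` F1 `|` F2)) g s =
   \sum_(s <- fset_set (F0 `|` F1 `|` F2)) Num.max (g s) 0 -
   \sum_(s <- fset_set (F0 `|` F1 `|` F2)) Num.max (- g s) 0.
  rewrite -sumrB; apply: eq_bigr => s _; rewrite /Num.max.
  by case: ifPn; case: ifPn; rewrite -?leNgt; lra.
move: h1 h2; rewrite ler_norml; lra.
Qed.

End UnorderedSum.

(** * Small increments on intervals without large jumps *)

Section Oscillation.
Variables (R : realType) (T : R) (x : R -> R) (pi : nat -> seq R).
Hypothesis xc : cadlag T x.

(** For w in (u, v] the large jumps up to w are the same as those up to v, so x
    itself oscillates as little as x minus its large jumps on (u, v]; the left
    endpoint is added by right-continuity. *)
Lemma increment_le_oscillation p eps e uv : itv_partition 0 T p ->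
  (max_oscillation (fun t => x t - large_jumps T x eps t)%R p < e%:E)%E ->
  uv \in intervals p ->
  (forall s, jumps_ge T x eps s -> ~~ contains s uv) ->
  `|x uv.2 - x uv.1| <= e.
Proof.
move=> pT osc uvp nojump; have [u0 uv_lt vT] := interval_bounds pT uvp.
have close w : uv.1 < w <= uv.2 -> `|x uv.2 - x w| <= e.
  move=> uw; rewrite -lee_fin; apply: le_trans (ltW osc).
  have -> : x uv.2 - x w =
    (x uv.2 - large_jumps T x eps uv.2) - (x w - large_jumps T x eps w).
    have -> : large_jumps T x eps uv.2 = large_jumps T x eps w; last by ring.
    rewrite /large_jumps; suff -> : jumps_ge T x eps `&` `[0, uv.2] =
      jumps_ge T x eps `&` `[0, w] by [].
    apply/seteqP; split => t [Jt] /=; rewrite in_itv /= => t0; split=> //=;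
      rewrite in_itv /=; last by lra.
    by move: (nojump _ Jt); rewrite /contains; lra.
  apply: le_trans (le_bigmax_seq _ uv xpredT _ uvp isT).
  by apply: ereal_sup_ubound; exists (w, uv.2) => //=; split; rewrite /= in_itv /=; lra.
have xu : x w @[w --> uv.1^'+] --> x uv.1 by case: xc => /(_ uv.1) + _; apply; lra.
have xuv : `|x uv.2 - x w| @[w --> uv.1^'+] --> `|x uv.2 - x uv.1|.
  by apply: cvg_norm; apply: cvgB => //; exact: cvg_cst.
rewrite -(cvg_lim _ xuv)//; apply: limr_le; first by apply/cvg_ex; eexists; exact: xuv.
near=> w; apply: close; apply/andP; split; near: w; first exact: nbhs_right_gt.
exact: nbhs_right_le.
Unshelve. all: by end_near. Qed.

Lemma small_oscillation e :
  limf_esup (fun eps : R =>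
    limn_esup (fun n : nat =>
      max_oscillation (fun t => x t - large_jumps T x eps t)%R (pi n)))
    (0 : R)^'+ = 0%E -> 0 < e ->
  exists2 eps, 0 < eps & \forall n \near \oo,
    (max_oscillation (fun t => x t - large_jumps T x eps t)%R (pi n) < e%:E)%E.
Proof.
move=> A1 e0.
have : (limf_esup (fun eps : R =>
    limn_esup (fun n : nat =>
      max_oscillation (fun t => x t - large_jumps T x eps t)%R (pi n)))
    (0 : R)^'+ < e%:E)%E by rewrite A1 lte_fin.
move=> /ereal_inf_lt[_ [V V0 <-]] supV.
have [eps [Veps eps0]] : exists eps, V eps /\ 0 < eps.
  by apply: (@filter_ex _ (0 : R)^'+); apply: filterI => //; exact: nbhs_right_gt.
exists eps => //.
have : (limn_esup (fun n : nat =>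
      max_oscillation (fun t => x t - large_jumps T x eps t)%R (pi n)) < e%:E)%E.
  by apply: le_lt_trans supV; apply: ereal_sup_ubound; exists eps.
move=> /ereal_inf_lt[_ [N N_oo <-]] supN.
apply: filterS N_oo => n Nn; apply: le_lt_trans supN.
by apply: ereal_sup_ubound; exists n.
Qed.

End Oscillation.

(** * Sums over the intervals that contain given jump times *)

Lemma near_all (I : eqType) (r : seq I) (P : I -> nat -> Prop) :
  (forall i, i \in r -> \forall n \near \oo, P i n) ->
  \forall n \near \oo, forall i, i \in r -> P i n.
Proof.
elim: r => [|a r IH] H; first by near=> n.
have Pa := H a (mem_head _ _).
have /IH : forall i, i \in r -> \forall n \near \oo, P i n.
  by move=> i ir; apply: H; rewrite inE ir orbT.
by apply: filterS2 Pa => n Pan Pn i; rewrite inE => /predU1P[->//|/Pn].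
Unshelve. all: by end_near. Qed.

(** Each interval meets ds at most once, so that summing over the times in ds
    counts no interval twice. *)
Lemma sum_over_separated (R : realType) (T : R) (p ds : seq R) (G : R * R -> R) :
  itv_partition 0 T p -> uniq ds -> (forall s, s \in ds -> 0 < s <= T) ->
  (forall s t, s \in ds -> t \in ds -> s != t -> interval_at p s != interval_at p t) ->
  \sum_(uv <- intervals p | has (fun s => contains s uv) ds) G uv =
  \sum_(s <- ds) G (interval_at p s).
Proof.
move=> pT ds_uniq dsT sep.
have -> : \sum_(s <- ds) G (interval_at p s) =
    \sum_(s <- ds) \sum_(uv <- intervals p | contains s uv) G uv.
  rewrite big_seq [RHS]big_seq; apply: eq_bigr => s sds.
  by rewrite (sum_contains _ pT (dsT _ sds)).
rewrite (exchange_big_dep xpredT)//= big_mkcond big_seq [RHS]big_seq.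
apply: eq_bigr => uv uvp; rewrite big_const_seq iter_addr_0 has_count.
suff : (count (fun s => contains s uv) ds <= 1)%N by case: count => [|[]].
rewrite -size_filter.
have := filter_uniq (fun s => contains s uv) ds_uniq.
have : forall s, s \in [seq s <- ds | contains s uv] ->
    s \in ds /\ uv = interval_at p s.
  move=> s; rewrite mem_filter => /andP[c sds]; split => //.
  exact: (interval_at_unique pT (dsT _ sds)).
case: [seq s <- ds | contains s uv] => [//|s [//|t r]] H /= /andP[].
rewrite inE negb_or => /andP[st _] _.
have [sds es] : s \in ds /\ uv = interval_at p s by apply: H; rewrite inE eqxx.
have [tds et] : t \in ds /\ uv = interval_at p t by apply: H; rewrite !inE eqxx orbT.
by have := sep _ _ sds tds st; rewrite -es -et eqxx.
Qed.

Section JumpSums.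
Variables (R : realType) (T : R) (x : R -> R) (pi : nat -> seq R) (q : R).
Hypothesis T0 : 0 < T.
Hypothesis xc : cadlag T x.
Hypothesis piT : forall n, itv_partition 0 T (pi n).
Hypothesis left_endpoint_cvg : forall s : R, 0 < s <= T ->
  x (lower_endpoint (pi n) s) @[n --> \oo] --> left_limit x s.
Hypothesis Qq : quadratic_sum x (pi n) T @[n --> \oo] --> q.

Lemma quadratic_sum_TE n :
  quadratic_sum x (pi n) T = \sum_(uv <- intervals (pi n)) (x uv.2 - x uv.1) ^+ 2.
Proof.
rewrite /quadratic_sum big_seq [RHS]big_seq; apply: eq_bigr => uv.
by move=> /(interval_bounds (piT n))[_ uv_lt vT]; rewrite !min_l//; lra.
Qed.

Lemma jump_endpoints_cvg s : jumps T x s ->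
  x (interval_at (pi n) s).1 @[n --> \oo] --> left_limit x s /\
  x (interval_at (pi n) s).2 @[n --> \oo] --> x s.
Proof.
move=> [sT]; rewrite normr_gt0 => Js; split; first exact: left_endpoint_cvg.
have : x (Num.min (interval_at (pi n) s).2 T) @[n --> \oo] --> x s.
  by apply: (jump_right_endpoint_cvg xc piT left_endpoint_cvg) => //; right.
under eq_fun => n.
  have [/(interval_bounds (piT n))[_ _ vT] _] := interval_atP (piT n) sT.
  rewrite (min_l vT); over.
by [].
Qed.

Lemma sum_jump_intervals F : fsets (jumps T x) F -> \forall n \near \oo,
  forall G : R * R -> R,
  \sum_(uv <- intervals (pi n) | has (fun s => contains s uv) (fset_set F)) G uv =
  \sum_(s <- fset_set F) G (interval_at (pi n) s).
Proof.
move=> [fF FJ].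
have FJ' s : s \in (fset_set F : seq R) -> 0 < s <= T /\ jump x s != 0.
  by rewrite in_fset_set// in_setE => /FJ[sT]; rewrite normr_gt0.
have : \forall n \near \oo, forall s, s \in (fset_set F : seq R) ->
    forall t, t \in (fset_set F : seq R) -> s != t ->
    interval_at (pi n) s != interval_at (pi n) t.
  apply: near_all => s /FJ'[sT Js]; apply: near_all => t /FJ'[tT Jt].
  have [->|st] := eqVneq s t; first by near=> n.
  have := jump_intervals_distinct xc piT left_endpoint_cvg sT tT Js Jt st.
  by apply: filterS.
apply: filterS => n sep G.
apply: (sum_over_separated _ (piT n)) => [|s /FJ'[]//|s t sF tF]; first exact: fset_uniq.
exact: sep.
Unshelve. all: by end_near. Qed.

(** The intervals around the jumps in F are eventually disjoint, their squared
    increments tend to the squared jumps, and they are part of the quadratic sum. *)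
Lemma sum_jump_sqr_le F : fsets (jumps T x) F ->
  \sum_(s <- fset_set F) jump x s ^+ 2 <= q.
Proof.
move=> FJ; have [fF FJ'] := FJ.
have lim : \sum_(s <- fset_set F)
      (x (interval_at (pi n) s).2 - x (interval_at (pi n) s).1) ^+ 2 @[n --> \oo] -->
    \sum_(s <- fset_set F) jump x s ^+ 2.
  rewrite !big_seq; under eq_fun do rewrite big_seq.
  apply: cvg_big => [|s]; first exact: add_continuous.
  rewrite in_fset_set// in_setE => /FJ'/jump_endpoints_cvg[us vs].
  by apply: cvgM; exact: cvgB.
rewrite -(cvg_lim _ lim)// -(cvg_lim _ Qq)//.
apply: ler_lim; [by apply/cvg_ex; eexists; exact: lim|by apply/cvg_ex; exists q|].
have := sum_jump_intervals FJ; apply: filterS => n sumE.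
rewrite -(sumE (fun uv => (x uv.2 - x uv.1) ^+ 2)) quadratic_sum_TE.
rewrite [leRHS](bigID (fun uv => has (fun s => contains s uv) (fset_set F)))/=.
by rewrite lerDl sumr_ge0// => uv _; exact: sqr_ge0.
Qed.

Variable f : R -> R.
Hypothesis f_C2 : twice_continuously_differentiable f.

(** The terms are Taylor remainders between x(s-) and x(s), of the order of the
    squared jumps. *)
Lemma jump_correction_summable : summable (jumps T x) (EFin \o jump_correction f x).
Proof.
have [M M0 xM] := cadlag_bounded xc T0.
have [C C0 remC] := taylor_remainder_bounded f_C2 M.
apply: (@le_lt_trans _ _ (C * q)%:E); last by rewrite ltry.
apply: ge_ereal_sup => _ [F FJ <-]; have [fF FJ'] := FJ.
rewrite fsbig_finite//= sumEFin lee_fin.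
apply: (@le_trans _ _ (C * \sum_(s <- fset_set F) jump x s ^+ 2)); last first.
  by rewrite ler_wpM2l// sum_jump_sqr_le.
rewrite mulr_sumr big_seq [leRHS]big_seq; apply: ler_sum => s.
rewrite in_fset_set// in_setE => /FJ'[sT _]; apply: remC.
  exact: (left_limit_bounded xc xM).
by apply: xM; lra.
Qed.

Hypothesis A1 : limf_esup (fun eps : R =>
    limn_esup (fun n : nat =>
      max_oscillation (fun t => x t - large_jumps T x eps t)%R (pi n)))
    (0 : R)^'+ = 0%E.

(** With an error of e / 3 for each of the following: the replacement of J by a
    finite sum over F, the convergence of the intervals around the times in F to
    this sum, and the remaining intervals, on which x has small increments. *)
Lemma taylor_remainder_sum_cvg :
  \sum_(uv <- intervals (pi n)) taylor_remainder f (x uv.1) (x uv.2)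
    @[n --> \oo] --> unordered_sum (jumps T x) (jump_correction f x).
Proof.
apply/cvgrPdist_le => e e0; have e30 : 0 < e / 3 by rewrite divr_gt0.
have [M M0 xM] := cadlag_bounded xc T0.
have q0 : 0 <= q.
  rewrite -(cvg_lim _ Qq)//; apply: limr_ge; first by apply/cvg_ex; exists q.
  by near=> n; apply: sumr_ge0 => uv _; exact: sqr_ge0.
have eta0 : 0 < e / 3 / (q + 1) by rewrite divr_gt0// ltr_wpDl.
have [d d0 remd] := taylor_remainder_small f_C2 M eta0.
have [eps eps0 osc] := small_oscillation A1 d0.
have largeJ : fsets (jumps T x) (jumps_ge T x eps).
  split; first exact: jumps_ge_finite.
  by move=> s [sT Js]; split=> //; exact: lt_le_trans Js.
have [F [FJ largeF] FJ_sum] := unordered_sum_approx jump_correction_summable largeJ e30.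
have [fF FJ'] := FJ.
have lim : \sum_(s <- fset_set F) taylor_remainder f
      (x (interval_at (pi n) s).1) (x (interval_at (pi n) s).2) @[n --> \oo] -->
    \sum_(s <- fset_set F) jump_correction f x s.
  rewrite !big_seq; under eq_fun do rewrite big_seq.
  apply: cvg_big => [|s]; first exact: add_continuous.
  rewrite in_fset_set// in_setE => /FJ'/jump_endpoints_cvg[us vs].
  exact: (taylor_remainder_cvg f_C2).
have /cvgr_dist_le /(_ _ e30) near_lim := lim.
have near_sum := sum_jump_intervals FJ.
have /cvgr_le /(_ (q + 1)) := Qq; rewrite ltrDl ltr01 => /(_ isT) near_q.
near=> n.
have sumE : forall G : R * R -> R,
    \sum_(uv <- intervals (pi n) | has (fun s => contains s uv) (fset_set F)) G uv =
    \sum_(s <- fset_set F) G (interval_at (pi n) s) by near: n.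
have Hosc : (max_oscillation (fun t => x t - large_jumps T x eps t)%R (pi n) < d%:E)%E.
  by near: n.
have Hlim : `|\sum_(s <- fset_set F) jump_correction f x s -
    \sum_(s <- fset_set F) taylor_remainder f
      (x (interval_at (pi n) s).1) (x (interval_at (pi n) s).2)| <= e / 3 by near: n.
have Hq : quadratic_sum x (pi n) T <= q + 1 by near: n.
rewrite (bigID (fun uv => has (fun s => contains s uv) (fset_set F)))/=.
rewrite (sumE (fun uv => taylor_remainder f (x uv.1) (x uv.2))).
have rest : `|\sum_(uv <- intervals (pi n) | ~~ has (fun s => contains s uv) (fset_set F))
    taylor_remainder f (x uv.1) (x uv.2)| <= e / 3.
  apply: (@le_trans _ _ (e / 3 / (q + 1) * quadratic_sum x (pi n) T)); last first.
    rewrite -[leRHS](@divfK _ (q + 1)) ?lt0r_neq0 ?ltr_wpDl//.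
    by rewrite ler_wpM2l// ltW.
  rewrite quadratic_sum_TE mulr_sumr (le_trans (ler_norm_sum _ _ _))//.
  rewrite big_mkcond big_seq [leRHS]big_seq; apply: ler_sum => uv uvp.
  have [u0 uv_lt vT] := interval_bounds (piT n) uvp.
  case: ifPn => [/hasPn nojump|_]; last by rewrite mulr_ge0 ?sqr_ge0// ltW.
  apply: remd; [by apply: xM; lra|by apply: xM; lra|].
  apply: (increment_le_oscillation xc (piT n) Hosc uvp) => s /largeF Fs.
  by apply: nojump; rewrite in_fset_set// in_setE.
move: FJ_sum Hlim rest; rewrite !ler_norml; lra.
Unshelve. all: by end_near. Qed.

End JumpSums.

(** * Existence of the limits *)

Theorem theorem1 (R : realType) (T : R) (x : R -> R) (pi : nat -> seq R)
    (qv : R -> R)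
    (T_gt0 : 0 < T)
    (x_cadlag : cadlag T x)
    (pi_partition : forall n, itv_partition 0 T (pi n))
    (A1 : limf_esup (fun eps : R =>
            limn_esup (fun n : nat =>
              max_oscillation (fun t => x t - large_jumps T x eps t) (pi n)))
            (0 : R)^'+ = 0%E)
    (A2 : forall s : R, 0 < s <= T ->
            x (lower_endpoint (pi n) s) @[n --> \oo] --> left_limit x s)
    (qv_ge0 : forall t : R, 0 <= t <= T -> 0 <= qv t)
    (qv_nondecreasing : forall s t : R, 0 <= s -> s <= t -> t <= T ->
       qv s <= qv t)
    (qv_limit : forall t : R, 0 <= t <= T ->
       [\/ qv s @[s --> within `[0, T] (nbhs t)] --> qv t,
           t = T |
           0 < t /\ jump x t <> 0] ->
       quadratic_sum x (pi n) t @[n --> \oo] --> qv t) :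
  forall f : R -> R, twice_continuously_differentiable f ->
  exists I : R,
    [/\ \sum_(uv <- intervals (pi n)) derive1n 2 f (x uv.1) * (x uv.2 - x uv.1) ^+ 2
          @[n --> \oo] --> I,
        summable (jumps T x) (EFin \o jump_correction f x) &
        \sum_(uv <- intervals (pi n)) derive1 f (x uv.1) * (x uv.2 - x uv.1)
          @[n --> \oo] -->
        f (x T) - f (x 0) - 2^-1 * I
          - unordered_sum (jumps T x) (jump_correction f x)].
Proof.
move=> f f_C2.
have good_T : quadratic_sum x (pi n) T @[n --> \oo] --> qv T.
  by apply: qv_limit; [rewrite lexx ltW|constructor 2].
have f''_cont : continuous (derive1n 2 f) by case: f_C2.
have /cvg_ex[I SI] : cvgn (fun n => weighted_sum x (derive1n 2 f) (pi n) T).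
  apply: (weighted_sum_cvg T_gt0 x_cadlag pi_partition A2 f''_cont).
  - by apply/cvg_ex; exists (qv T).
  - move=> t tT /eqP Jt; apply/cvg_ex; exists (qv t); apply: qv_limit; first by lra.
    by constructor 3; split=> //; case/andP: tT.
  - move=> a b a0 ab bT.
    have ndqv : {in `[a, b] &, nondecreasing_fun qv}.
      move=> s t; rewrite !in_itv /= => sab tab st.
      by apply: qv_nondecreasing => //; lra.
    have [t tab qvt] := nondecreasing_continuity_point ab ndqv.
    exists t => //; apply/cvg_ex; exists (qv t); apply: qv_limit; first by lra.
    by constructor 1; apply: cvg_within_filter.
have SE n : weighted_sum x (derive1n 2 f) (pi n) T =
    \sum_(uv <- intervals (pi n)) derive1n 2 f (x uv.1) * (x uv.2 - x uv.1) ^+ 2.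
  rewrite /weighted_sum big_seq [RHS]big_seq; apply: eq_bigr => uv uvp.
  have [_ uv_lt vT] := interval_bounds (pi_partition n) uvp.
  by rewrite /stopped_square !min_l//; lra.
exists I; split.
- by under eq_fun do rewrite -SE.
- exact: (jump_correction_summable T_gt0 x_cadlag pi_partition A2 good_T f_C2).
have remJ := taylor_remainder_sum_cvg T_gt0 x_cadlag pi_partition A2 good_T f_C2 A1.
have -> : (fun n => \sum_(uv <- intervals (pi n)) derive1 f (x uv.1) * (x uv.2 - x uv.1)) =
  (fun n => f (x T) - f (x 0) - 2^-1 * weighted_sum x (derive1n 2 f) (pi n) T -
    \sum_(uv <- intervals (pi n)) taylor_remainder f (x uv.1) (x uv.2)).
  apply/funext => n; rewrite SE -(sum_increments (fun t => f (x t)) (pi_partition n)).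
  rewrite mulr_sumr -!sumrB; apply: eq_bigr => uv _.
  rewrite /taylor_remainder mulrA.
  move: (f _ - f _) (derive1 f _ * _) (2^-1 * _ * _) => df lin quad.
  by rewrite opprB addrA addrNK opprB addrC subrK.
apply: cvgB => //; apply: cvgB; first exact: cvg_cst.
by apply: cvgM => //; exact: cvg_cst.
Qed.
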